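(* Let $b\in C^1(I_{2\varepsilon};\mathbb R)$ be such that there exists $\mathfrak m_b>0$ with $b'(x)\leqslant-\mathfrak m_b$ for every $x\in I_{2\varepsilon}$. Then there exists a constant $C>0$, depending at most on $b$, $\mathfrak m_b$, $K$, $\mathtt l_0$, $\mathtt r_0$ and $\varepsilon$, such that for every integrable estimator $\widehat b$ of $b$ on $I_{2\varepsilon}$, every nonempty finite subset $\mathfrak H_b$ of $(0,\min\{1,\mathfrak m_b\}\varepsilon)$, and every (measurable) choice of $$(\widehat\ell,\widehat h)\in\underset{(\ell,h)\in\mathfrak H_b^2}{\mathrm{argmin}}\left\{\int_{I_0}|\widehat b_{\ell,h}(x)-\widehat b(x)|\,dx\right\},$$ one has $$\int_{I_0}\mathbb E(|\widehat b_{\widehat\ell,\widehat h}(x)-b(x)|)\,dx\leqslant C\left(\min_{(\ell,h)\in\mathfrak H_b^2}\left\{\int_{I_0}\mathbb E(|\widehat b_{\ell,h}(x)-b(x)|)\,dx\right\}+\mathcal R(\widehat b)\right).$$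
   Context: Let $\mathtt l_0<\mathtt r_0$ be real numbers and $\varepsilon\in(0,1]$. Put $I_0=[\mathtt l_0,\mathtt r_0]$ and, for $\lambda>0$, $\mathtt l_\lambda=\mathtt l_0-\lambda$, $\mathtt r_\lambda=\mathtt r_0+\lambda$, $I_\lambda=[\mathtt l_\lambda,\mathtt r_\lambda]$. Let $K\in C^2(\mathbb R;\mathbb R_+)$ be a kernel ($\int_{\mathbb R}K=1$) which is symmetric and supported in $[-1,1]$, and for $\eta\in(0,1]$ let $K_\eta(u)=\frac1\eta K(\frac u\eta)$. An integrable estimator $\widehat b$ of $b$ on $I_{2\varepsilon}$ is a (jointly measurable) random function $\widehat b:\Omega\times I_{2\varepsilon}\to\mathbb R$ on a probability space $(\Omega,\mathcal A,\mathbb P)$, integrable on $I_{2\varepsilon}$. Its integrated $\mathbb L^1$-risk is $\mathcal R(\widehat b)=\int_{I_{2\varepsilon}}\mathbb E(|\widehat b(x)-b(x)|)\,dx$. For $b$ strictly decreasing, $b(I_\varepsilon)=[b(\mathtt r_\varepsilon),b(\mathtt l_\varepsilon)]$. Define, for $w\in\mathbb R$ and $x\in I_0$, $$\widehat{\mathfrak b}_h^{-1}(w)=\mathtt l_{2\varepsilon}+\int_{I_{2\varepsilon}}\int_{-\infty}^{-w}K_h(-\widehat b(z)-y)\,dy\,dz,\qquad \widehat b_{\ell,h}(x)=b(\mathtt r_\varepsilon)+\int_{b(I_\varepsilon)}\int_{-\infty}^{-x}K_\ell(-\widehat{\mathfrak b}_h^{-1}(z)-y)\,dy\,dz.$$ (Here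 $\widehat{\mathfrak b}_h^{-1}$ is just a notation for the function so defined.) *)

(* Defs.v *)
From HB Require Import structures.
From mathcomp Require Import all_boot all_order all_algebra.
From mathcomp Require Import finmap.
From mathcomp Require Import all_classical all_reals all_analysis.

Set Implicit Arguments.
Unset Strict Implicit.
Unset Printing Implicit Defensive.

Import Order.TTheory GRing.Theory Num.Theory.
Import numFieldNormedType.Exports.

Local Open Scope classical_set_scope.
Local Open Scope ring_scope.

(* The interval I_lam = [l - lam, r + lam] around [l, r]. *)
Definition Ilam (R : realType) (l r lam : R) : set R :=
  `[l - lam, r + lam]%classic.

(* Derivative relative to a set A: the difference quotient is taken over the
   points of A only, hence it is one-sided at the endpoints of an interval. *)
Definition derivable_within (R : realType) (A : set R) (f : R -> R) (x : R) :=
  cvg ((fun y => (f y - f x) / (y - x)) @ within A x^').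

Definition derive_within (R : realType) (A : set R) (f : R -> R) (x : R) : R :=
  lim ((fun y => (f y - f x) / (y - x)) @ within A x^').

Definition C1_on (R : realType) (A : set R) (f : R -> R) :=
  (forall x, A x -> derivable_within A f x) /\
  {within A, continuous (derive_within A f)}.

Definition C2 (R : realType) (f : R -> R) :=
  [/\ forall x, derivable f x 1,
      forall x, derivable (f^`()%classic) x 1 &
      continuous (f^`(2)%classic : R -> R)].

Definition C2_symmetric_kernel (R : realType) (K : R -> R) :=
  [/\ C2 K,
      forall x, 0 <= K x,
      (\int[lebesgue_measure]_x (K x)%:E = 1)%E,
      forall x, K (- x) = K x &
      forall x, x \notin `[-1, 1] -> K x = 0].

Definition scaled_kernel (R : realType) (K : R -> R) (eta u : R) : R :=
  eta^-1 * K (u / eta).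

(* An estimator is a function on Omega x R of which only the restriction to
   Omega x A is constrained.  No moment condition in omega is imposed: the
   paths are integrable on A almost surely. *)
Definition integrable_estimator (R : realType) (d : measure_display)
    (T : measurableType d) (P : probability T R) (A : set R)
    (bhat : T -> R -> R) :=
  measurable_fun ([set: T] `*` (A : set (measurableTypeR R)))
    (fun p : T * measurableTypeR R => bhat p.1 p.2) /\
  {ae P, forall w,
    (@lebesgue_measure R).-integrable A (fun x => (bhat w x)%:E)}.

(* Integrated L^1-risk on A; it may be +oo. *)
Definition L1_risk (R : realType) (d : measure_display)
    (T : measurableType d) (P : probability T R) (A : set R)
    (b : R -> R) (bhat : T -> R -> R) : \bar R :=
  (\int[lebesgue_measure]_(x in A) 'E_P[fun w => `|bhat w x - b x|%R])%E.

(* In the next three definitions f is a path of the estimator.  The inner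
   integrals lie in [0, 1] when the bandwidth is positive, so that the
   real-valued integrals are the genuine ones. *)
Definition inv_estimator (R : realType) (K : R -> R) (l0 r0 eps : R)
    (f : R -> R) (h w : R) : R :=
  l0 - 2 * eps +
  \int[lebesgue_measure]_(z in Ilam l0 r0 (2 * eps))
    \int[lebesgue_measure]_(y in `]-oo, - w]%classic)
      scaled_kernel K h (- f z - y).

Definition monotone_estimator (R : realType) (K : R -> R) (l0 r0 eps : R)
    (b f : R -> R) (l h x : R) : R :=
  b (r0 + eps) +
  \int[lebesgue_measure]_(z in b @` Ilam l0 r0 eps)
    \int[lebesgue_measure]_(y in `]-oo, - x]%classic)
      scaled_kernel K l (- inv_estimator K l0 r0 eps f h z - y).

Definition selection_criterion (R : realType) (K : R -> R) (l0 r0 eps : R)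
    (b f : R -> R) (l h : R) : \bar R :=
  (\int[lebesgue_measure]_(x in `[l0, r0]%classic)
     `|monotone_estimator K l0 r0 eps b f l h x - f x|%:E)%E.

(* p lies in argmin_(q \in S) F q *)
Definition is_argmin (R : realType) (I : choiceType) (S : {fset I})
    (F : I -> \bar R) (p : I) :=
  p \in S /\ forall q, q \in S -> (F p <= F q)%E.

(* Main.v *)
(* The constant 2 works.  Path by path the selected estimator F is at least as
   close to Z (the initial estimator) in L^1([l0, r0]) as any competitor G, so
   int |F - b| <= int |F - Z| + int |Z - b| <= int |G - Z| + int |Z - b|
               <= int |G - b| + 2 int |Z - b|.
   Integrating over Omega and exchanging the two integrals by Tonelli gives the
   bound.  The only real work is joint measurability of (omega, x) |-> F(x):
   each smoothed estimator is an iterated integral of a nonnegative jointly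
   measurable function, with bandwidths allowed to depend measurably on omega,
   so the random choice of bandwidths is not a separate case. *)
Require Import Defs.
From HB Require Import structures.
From mathcomp Require Import all_boot all_order all_algebra.
From mathcomp Require Import finmap.
From mathcomp Require Import all_classical all_reals all_analysis.
From mathcomp Require Import measurable_realfun.
From mathcomp Require Import lra.
Set Implicit Arguments.
Unset Strict Implicit.
Unset Printing Implicit Defensive.
Import Order.TTheory GRing.Theory Num.Theory.
Import numFieldNormedType.Exports.
Local Open Scope classical_set_scope.
Local Open Scope ring_scope.

(** * Measurability of inversion, continuity from one-sided derivatives *)

Lemma measurable_inv (R : realType) :
  measurable_fun [set: R] (GRing.inv : R -> R).
Proof.
(* Inversion is discontinuous at 0, so the line is cut into an open set, where it is continuous, and
   a point. *)
have -> : [set: R] = [set x | x != 0] `|` [set 0].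
  apply/seteqP; split=> // x _; have [->|x0] := eqVneq x 0; [by right|by left].
have oD : open [set x : R | x != 0] by exact: open_neq.
apply/measurable_funU => //; first exact: open_measurable.
split; last exact: measurable_fun_set1.
apply: open_continuous_measurable_fun => // x /set_mem /= x0.
exact: inv_continuous.
Qed.

(** The difference quotient converges and [y - x] tends to 0, so their product tends to 0. This
    yields the continuity of [b] up to the endpoints. *)
Lemma derivable_within_continuous_within (R : realType) (A : set R)
    (f : R -> R) :
  (forall x, A x -> derivable_within A f x) -> {within A, continuous f}.
Proof.
move=> df; apply/subspace_continuousP => x Ax.
have yx0 : (fun y => y - x) @ within A x^' --> (0 : R).
  have yx : (fun y => y - x) @ x --> (0 : R).
    rewrite -[X in _ --> X](subrr x).
    by apply: cvgB; [exact: cvg_id|exact: cvg_cst].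
  apply/cvgrPdist_lt => e e0; rewrite !near_withinE.
  have /cvgrPdist_lt/(_ e e0) := yx.
  by apply: filterS.
have fx0 :
    (fun y => (f y - f x) / (y - x) * (y - x)) @ within A x^' --> (0 : R).
  by rewrite -(mulr0 (derive_within A f x)); apply: cvgM (df x Ax) yx0.
apply/cvgrPdist_lt => e e0; have /cvgrPdist_lt/(_ e e0) := fx0.
(* The punctured filter says nothing at [y = x], where the increment of [f] is 0 anyway. *)
rewrite !near_withinE; apply: filterS => y /= + Ay.
have [->|yx] := eqVneq y x; first by rewrite subrr normr0.
by move=> /(_ isT Ay); rewrite sub0r normrN divfK ?subr_eq0// distrC.
Qed.

(** * Measurability of integrals with parameters and of the smoothed estimators *)

Lemma measurable_Rintegral_xsection (R : realType) (d : measure_display)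
    (T : measurableType d) (E : set (T * measurableTypeR R)) (f : T -> R -> R) :
  measurable E ->
  measurable_fun [set: T * measurableTypeR R] (fun p => f p.1 p.2) ->
  (forall t y, 0 <= f t y) ->
  measurable_fun [set: T]
    (fun t => \int[lebesgue_measure]_(y in [set y | E (t, y)]) f t y).
Proof.
move=> mE mf f0.
pose g (p : T * measurableTypeR R) : \bar R :=
  (((fun p => f p.1 p.2) \_ E) p)%:E.
(* Restricting the integrand to [E] turns the moving domain into the whole line, so that Tonelli
   applies; [fine] is measurable even at infinite values. *)
have -> : (fun t => \int[lebesgue_measure]_(y in [set y | E (t, y)]) f t y) =
    fine \o fubini_F (@lebesgue_measure R) g.
  apply/funext => t /=; rewrite Rintegral_mkcond /fubini_F /g /Rintegral.
  by congr fine; apply: eq_integral.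
apply: measurableT_comp; first exact: fine_measurable.
apply: measurable_fun_fubini_tonelli_F.
  have mfE := (measurable_restrictT _ mE).1 (measurable_funTS mf).
  exact/measurable_EFinP.
by move=> p; rewrite lee_fin /patch; case: ifP.
Qed.


Lemma measurable_scaled_kernel_primitive (R : realType) (K : R -> R)
    (d : measure_display) (T : measurableType d) (h g x : T -> R) :
  continuous K -> (forall u, 0 <= K u) -> (forall t, 0 < h t) ->
  measurable_fun [set: T] h -> measurable_fun [set: T] g ->
  measurable_fun [set: T] x ->
  measurable_fun [set: T] (fun t =>
    \int[lebesgue_measure]_(y in `]-oo, - x t]%classic)
      scaled_kernel K (h t) (- g t - y)).
Proof.
move=> cK K0 h0 mh mg mx.
(* The moving half-line []-oo, - x t]] is the section of this measurable set at [t]. *)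
pose E : set (T * measurableTypeR R) := [set p | p.2 <= - x p.1].
have fst_comp (u : T -> R) : measurable_fun [set: T] u ->
    measurable_fun [set: T * measurableTypeR R] (fun p => u p.1).
  by move=> mu; exact: measurableT_comp.
have mE : measurable E.
  rewrite -[E]setTI; apply: measurable_fun_le => //.
  by apply: measurableT_comp => //; exact: fst_comp.
have mV : measurable_fun [set: T * measurableTypeR R] (fun p => (h p.1)^-1).
  by apply: measurableT_comp (measurable_inv (R:=R)) _; exact: fst_comp.
under eq_fun do rewrite set_itvE.
apply: (@measurable_Rintegral_xsection _ _ _ E
  (fun t y => scaled_kernel K (h t) (- g t - y))) => //.
- apply: measurable_funM => //; apply: measurableT_comp.
    exact: continuous_measurable_fun.
  apply: measurable_funM => //; apply: measurable_funB => //.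
  by apply: measurableT_comp => //; exact: fst_comp.
- by move=> t y; rewrite mulr_ge0// invr_ge0 ltW.
Qed.

Lemma Rintegral_scaled_kernel_ge0 (R : realType) (K : R -> R) (D : set R)
    (h a : R) :
  (forall u, 0 <= K u) -> 0 < h ->
  0 <= \int[lebesgue_measure]_(y in D) scaled_kernel K h (a - y).
Proof.
by move=> K0 h0; apply: Rintegral_ge0 => y _; rewrite mulr_ge0// invr_ge0 ltW.
Qed.

Lemma measurable_Rintegral (R : realType) (d : measure_display)
    (T : measurableType d) (D : set R) (f : T -> R -> R) :
  measurable (D : set (measurableTypeR R)) ->
  measurable_fun [set: T * measurableTypeR R] (fun p => f p.1 p.2) ->
  (forall t y, 0 <= f t y) ->
  measurable_fun [set: T] (fun t => \int[lebesgue_measure]_(y in D) f t y).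
Proof.
move=> mD mf f0.
have -> : (fun t => \int[lebesgue_measure]_(y in D) f t y) = (fun t =>
    \int[lebesgue_measure]_(y in [set y | (setT `*` D) (t, y)]) f t y).
  apply/funext => t; congr (Rintegral _ _ _).
  by apply/seteqP; split=> y //= [].
by apply: measurable_Rintegral_xsection => //; exact: measurableX.
Qed.

(** The parameter space [T] is kept abstract because it becomes a product in
    [measurable_monotone_estimator], whose second factor carries the outer integration variable. *)
Lemma measurable_inv_estimator (R : realType) (K : R -> R) (l0 r0 eps : R)
    (d : measure_display) (T : measurableType d) (f : T -> R -> R)
    (h x : T -> R) :
  continuous K -> (forall u, 0 <= K u) -> (forall t, 0 < h t) ->
  measurable_fun [set: T * measurableTypeR R] (fun p => f p.1 p.2) ->
  measurable_fun [set: T] h -> measurable_fun [set: T] x ->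
  measurable_fun [set: T]
    (fun t => inv_estimator K l0 r0 eps (f t) (h t) (x t)).
Proof.
move=> cK K0 h0 mf mh mx; apply: measurable_funD => //.
apply: measurable_Rintegral => [||t y]; first exact: measurable_itv.
- by apply: measurable_scaled_kernel_primitive => //;
    exact: measurableT_comp.
- exact: Rintegral_scaled_kernel_ge0.
Qed.

Lemma measurable_monotone_estimator (R : realType) (K : R -> R)
    (l0 r0 eps : R) (b : R -> R) (d : measure_display) (T : measurableType d)
    (f : T -> R -> R) (l h x : T -> R) :
  continuous K -> (forall u, 0 <= K u) ->
  {within Ilam l0 r0 eps, continuous b} ->
  (forall t, 0 < l t) -> (forall t, 0 < h t) ->
  measurable_fun [set: T * measurableTypeR R] (fun p => f p.1 p.2) ->
  measurable_fun [set: T] l -> measurable_fun [set: T] h ->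
  measurable_fun [set: T] x ->
  measurable_fun [set: T]
    (fun t => monotone_estimator K l0 r0 eps b (f t) (l t) (h t) (x t)).
Proof.
move=> cK K0 cb l0_ h0 mf ml mh mx; apply: measurable_funD => //.
apply: measurable_Rintegral => [||t y].
(* Continuity of [b] makes the outer domain, the image of a segment, compact. *)
- apply: compact_measurable; apply: continuous_compact => //.
  exact: segment_compact.
- apply: measurable_scaled_kernel_primitive => //;
    [exact: measurableT_comp| |exact: measurableT_comp].
  apply: (@measurable_inv_estimator _ _ _ _ _ _ _
    (fun p : T * measurableTypeR R => f p.1) (fun p => h p.1)) => //.
  + apply: (measurableT_comp mf
      (g := fun p : T * measurableTypeR R * measurableTypeR R => (p.1.1, p.2))).
    by apply: measurable_fun_pair => //; exact: measurableT_comp.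
  + exact: measurableT_comp.
- exact: Rintegral_scaled_kernel_ge0.
Qed.

Lemma C2_continuous (R : realType) (f : R -> R) : C2 f -> continuous f.
Proof.
by move=> [df _ _] x; apply/differentiable_continuous/derivable1_diffP.
Qed.

(** The path enters only through its values on the domain of the integral in [inv_estimator]. An
    estimator measurable on a strip may thus be replaced by its zero extension, measurable on the
    whole product. *)
Lemma monotone_estimator_patch (R : realType) (K : R -> R) (l0 r0 eps : R)
    (b f : R -> R) (l h x : R) :
  monotone_estimator K l0 r0 eps b (f \_ (Ilam l0 r0 (2 * eps))) l h x =
  monotone_estimator K l0 r0 eps b f l h x.
Proof.
have invE : inv_estimator K l0 r0 eps (f \_ (Ilam l0 r0 (2 * eps))) h =
    inv_estimator K l0 r0 eps f h.
  apply/funext => z; apply: (congr1 (+%R _)).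
  by apply: eq_Rintegral => u uA; rewrite patchE uA.
by rewrite /monotone_estimator invE.
Qed.

(** A binary minimum is one of its arguments, so the bound passes from the terms to the minimum; the
    neutral element [+oo] is handled by [0 < c] and [0 <= y]. *)
Lemma le_mule_bigmin (R : realType) (I : eqType) (s : seq I) (c : R)
    (x y : \bar R) (F : I -> \bar R) :
  0 < c -> (0 <= y)%E ->
  (forall i, i \in s -> (x <= c%:E * (F i + y))%E) ->
  (x <= c%:E * (\big[mine/+oo]_(i <- s) F i + y))%E.
Proof.
move=> c0 y0 xF; rewrite big_seq.
apply: (big_ind (fun v => x <= c%:E * (v + y))%E) => //.
- by rewrite addye ?gt0_muley ?leey ?lte_fin//; case: y y0 {xF}.
- by move=> u v xu xv; rewrite minEle; case: ifP.
Qed.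

(** * Tonelli's theorem for functions measurable on a strip *)

Section tonelli_on_a_strip.
Local Open Scope ereal_scope.
Context (R : realType) (d : measure_display) (T : measurableType d)
  (P : probability T R) (A : set R)
  (mA : measurable (A : set (measurableTypeR R))) (g : T -> R -> \bar R)
  (mg : measurable_fun ([set: T] `*` (A : set (measurableTypeR R)))
    (fun p : T * measurableTypeR R => g p.1 p.2))
  (g0 : forall w x, 0 <= g w x).

(** The zero extension of [g] turns integrals over [A] into integrals over the whole line. *)
Let G : T * measurableTypeR R -> \bar R :=
  (fun p => g p.1 p.2) \_ ([set: T] `*` A).

Let mG : measurable_fun [set: T * measurableTypeR R] G.
Proof.
by apply/(measurable_restrictT _ _).1 => //; exact: measurableX.
Qed.

Let G0 p : 0 <= G p.
Proof. by rewrite /G patchE; case: ifP. Qed.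

Let GE w x : G (w, x) = (g w \_ A) x.
Proof. by rewrite /G !patchE in_setX in_setT. Qed.

Lemma measurable_fun_integral_strip :
  measurable_fun [set: T] (fun w => \int[lebesgue_measure]_(x in A) g w x).
Proof.
have -> : (fun w => \int[lebesgue_measure]_(x in A) g w x) =
    fubini_F (@lebesgue_measure R) G.
  apply/funext => w; rewrite integral_mkcond.
  by apply: eq_integral => x _; rewrite GE.
exact: measurable_fun_fubini_tonelli_F.
Qed.

Lemma fubini_tonelli_strip :
  \int[lebesgue_measure]_(x in A) \int[P]_w g w x =
  \int[P]_w \int[lebesgue_measure]_(x in A) g w x.
Proof.
transitivity (\int[lebesgue_measure]_x \int[P]_w G (w, x)).
  rewrite integral_mkcond; apply: eq_integral => x _; rewrite patchE.
  case: ifPn => xA; first by apply: eq_integral => w _; rewrite GE patchE xA.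
  by rewrite integral0_eq// => w _; rewrite GE patchE (negbTE xA).
rewrite -(fubini_tonelli _ mG G0); apply: eq_integral => w _.
rewrite [RHS]integral_mkcond.
by apply: eq_integral => x _; rewrite GE.
Qed.

End tonelli_on_a_strip.

(** * The integrated risk: exchange of integrals, domain monotonicity, oracle inequality *)

Section L1_risk.
Local Open Scope ereal_scope.
Context (R : realType) (d : measure_display) (T : measurableType d)
  (P : probability T R).

Definition measurable_on (A : set R) (F : T -> R -> R) :=
  measurable_fun ([set: T] `*` (A : set (measurableTypeR R)))
    (fun p : T * measurableTypeR R => F p.1 p.2).

Lemma measurable_on_dist (A : set R) (F G : T -> R -> R) :
  measurable_on A F -> measurable_on A G ->
  measurable_on A (fun w x => `|F w x - G w x|%R).
Proof.
by move=> mF mG; apply: measurableT_comp => //; exact: measurable_funB.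
Qed.

Lemma measurable_on_section (A : set R) (F : T -> R -> R) w :
  measurable (A : set (measurableTypeR R)) ->
  measurable_on A F -> measurable_fun (A : set (measurableTypeR R)) (F w).
Proof.
move=> mA mF; have mX := measurableX (@measurableT _ T) mA.
have -> : F w = (fun p : T * measurableTypeR R => F p.1 p.2) \o pair w by [].
apply: (measurable_comp mX) => //; first by move=> _ [x Ax <-].
exact/measurable_funTS.
Qed.

Lemma measurable_on_snd (A : set R) (f : R -> R) :
  measurable (A : set (measurableTypeR R)) ->
  measurable_fun (A : set (measurableTypeR R)) f ->
  measurable_on A (fun=> f).
Proof.
move=> mA mf; apply: (measurable_comp mA _ mf (g := snd)).
  by move=> _ [[w x] [_ Ax] <-].
exact: measurable_funTS.
Qed.

(** With the expectation outside, inequalities proved path by path can be integrated over the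
    probability space. *)
Lemma L1_riskE (A : set R) (b : R -> R) (F : T -> R -> R) :
  measurable (A : set (measurableTypeR R)) ->
  measurable_fun (A : set (measurableTypeR R)) b -> measurable_on A F ->
  L1_risk P A b F =
  \int[P]_w \int[lebesgue_measure]_(x in A) `|F w x - b x|%:E.
Proof.
move=> mA mb mF; rewrite /L1_risk -fubini_tonelli_strip//.
- by apply: eq_integral => x _; rewrite unlock.
- apply/measurable_EFinP.
  exact: (measurable_on_dist mF (measurable_on_snd mA mb)).
Qed.

Lemma L1_risk_ge0 (A : set R) (b : R -> R) (F : T -> R -> R) :
  0 <= L1_risk P A b F.
Proof.
apply: integral_ge0 => x _; rewrite unlock.
by apply: integral_ge0 => w _; rewrite lee_fin.
Qed.

Lemma L1_risk_subset (A B : set R) (b : R -> R) (F : T -> R -> R) :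
  measurable (A : set (measurableTypeR R)) ->
  measurable (B : set (measurableTypeR R)) ->
  measurable_fun (B : set (measurableTypeR R)) b -> measurable_on B F ->
  A `<=` B -> L1_risk P A b F <= L1_risk P B b F.
Proof.
move=> mA mB mb mF AB.
have mX := measurableX (@measurableT _ T) mB.
have mbA : measurable_fun (A : set (measurableTypeR R)) b.
  exact: measurable_funS mb.
have mFA : measurable_on A F.
  by apply: measurable_funS mF => // p [_ /AB].
have mFb C : measurable (C : set (measurableTypeR R)) ->
    measurable_fun (C : set (measurableTypeR R)) b -> measurable_on C F ->
    measurable_fun [set: T]
      (fun w => \int[lebesgue_measure]_(x in C) `|F w x - b x|%:E).
  move=> mC mbC mFC; apply: measurable_fun_integral_strip => //.
  apply/measurable_EFinP.
  exact: (measurable_on_dist mFC (measurable_on_snd mC mbC)).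
rewrite !L1_riskE//; apply: ge0_le_integral => //.
- by move=> w _; apply: integral_ge0 => x _; rewrite lee_fin.
- exact: mFb.
- exact: mFb.
- move=> w _; apply: ge0_subset_integral => //.
  apply/measurable_EFinP; apply: measurableT_comp => //.
  by apply: measurable_funB => //; exact: measurable_on_section.
Qed.

(** Nothing is ever subtracted, so the argument stays valid when some risks are infinite. *)
Lemma L1_risk_oracle (A : set R) (b : R -> R) (F G Z : T -> R -> R) :
  measurable (A : set (measurableTypeR R)) ->
  measurable_fun (A : set (measurableTypeR R)) b ->
  measurable_on A F -> measurable_on A G -> measurable_on A Z ->
  (forall w, \int[lebesgue_measure]_(x in A) `|F w x - Z w x|%:E <=
             \int[lebesgue_measure]_(x in A) `|G w x - Z w x|%:E) ->
  L1_risk P A b F <= L1_risk P A b G + (L1_risk P A b Z + L1_risk P A b Z).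
Proof.
move=> mA mb mF mG mZ FGZ.
(* Seen as an estimator constant in [w], [b] can take any place in the triangle inequality
   [sectionD]. *)
have mb2 := measurable_on_snd mA mb.
have sectionD (U V W : T -> R -> R) w :
    measurable_on A U -> measurable_on A V -> measurable_on A W ->
    \int[lebesgue_measure]_(x in A) `|U w x - W w x|%:E <=
    \int[lebesgue_measure]_(x in A) `|U w x - V w x|%:E +
    \int[lebesgue_measure]_(x in A) `|V w x - W w x|%:E.
  move=> mU mV mW.
  have mD (U1 V1 : T -> R -> R) : measurable_on A U1 -> measurable_on A V1 ->
      measurable_fun (A : set (measurableTypeR R))
        (fun x => `|U1 w x - V1 w x|%:E).
    move=> mU1 mV1; apply/measurable_EFinP.
    exact: (measurable_on_section w mA (measurable_on_dist mU1 mV1)).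
  rewrite -ge0_integralD//; try exact: mD.
  apply: ge0_le_integral => //; first exact: mD.
    by apply: emeasurable_funD; exact: mD.
  by move=> x _; rewrite -EFinD lee_fin ler_distD.
have mI (U : T -> R -> R) : measurable_on A U -> measurable_fun [set: T]
    (fun w => \int[lebesgue_measure]_(x in A) `|U w x - b x|%:E).
  move=> mU; apply: measurable_fun_integral_strip => //.
  by apply/measurable_EFinP; exact: (measurable_on_dist mU mb2).
have I0 (U : T -> R -> R) w :
    0 <= \int[lebesgue_measure]_(x in A) `|U w x - b x|%:E.
  by apply: integral_ge0 => x _; rewrite lee_fin.
rewrite !L1_riskE// -!ge0_integralD//; try exact: mI.
- apply: ge0_le_integral => //; try exact: mI.
    by apply: emeasurable_funD; [exact: mI|apply: emeasurable_funD; exact: mI].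
  (* The first triangle inequality goes through [Z], then minimality replaces [F] by [G], and the
     second one goes through [b]. *)
  move=> w _; apply: (le_trans (sectionD F Z (fun=> b) w mF mZ mb2)).
  rewrite [leRHS]addeA; apply: leeD => //; apply: (le_trans (FGZ w)).
  apply: (le_trans (sectionD G (fun=> b) Z w mG mb2 mZ)).
  by apply: leeD => //; under eq_integral do rewrite distrC.
- by move=> w _; rewrite adde_ge0.
- by apply: emeasurable_funD; exact: mI.
Qed.

End L1_risk.

(** * Assembly: measurability of every estimator, then comparison with a fixed competitor *)

Theorem proposition2p3 (R : realType) (l0 r0 eps : R) (K b : R -> R) (m : R)
  (hlr : l0 < r0) (heps0 : 0 < eps) (heps1 : eps <= 1)
  (hK : C2_symmetric_kernel K)
  (hb : C1_on (Ilam l0 r0 (2 * eps)) b)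
  (hm : 0 < m)
  (hb' : forall x, Ilam l0 r0 (2 * eps) x ->
     derive_within (Ilam l0 r0 (2 * eps)) b x <= - m) :
  exists C : R, 0 < C /\
    forall (d : measure_display) (T : measurableType d) (P : probability T R)
      (bhat : T -> R -> R)
      (_ : integrable_estimator P (Ilam l0 r0 (2 * eps)) bhat)
      (H : {fset R}) (_ : H != fset0)
      (_ : {subset H <= `]0, Num.min 1 m * eps[})
      (lhat hhat : T -> R)
      (_ : measurable_fun [set: T] lhat) (_ : measurable_fun [set: T] hhat)
      (_ : forall w, is_argmin (H `*` H)%fset
         (fun p => selection_criterion K l0 r0 eps b (bhat w) p.1 p.2)
         (lhat w, hhat w)),
    (L1_risk P `[l0, r0]%classic b
       (fun w => monotone_estimator K l0 r0 eps b (bhat w) (lhat w) (hhat w))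
     <= C%:E *
        (\big[mine/+oo]_(p <- (H `*` H)%fset)
           L1_risk P `[l0, r0]%classic b
             (fun w => monotone_estimator K l0 r0 eps b (bhat w) p.1 p.2)
         + L1_risk P (Ilam l0 r0 (2 * eps)) b bhat))%E.
Proof.
exists 2; split=> // d T P bhat [mbhat _] H _ H0 lhat hhat mlhat mhhat hargmin.
have [/C2_continuous cK K0 _ _ _] := hK.
set A := Ilam l0 r0 (2 * eps); pose I0 : set R := `[l0, r0]%classic.
have mA : measurable (A : set (measurableTypeR R)) by exact: measurable_itv.
have mI0 : measurable (I0 : set (measurableTypeR R)) by exact: measurable_itv.
have I0A : I0 `<=` A.
  move=> x; rewrite /I0 /A /Ilam /= !in_itv/= => /andP[lx xr].
  by apply/andP; split; lra.
have IepsA : Ilam l0 r0 eps `<=` A.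
  move=> x; rewrite /A /Ilam /= !in_itv/= => /andP[lx xr].
  by apply/andP; split; lra.
have cb : {within A, continuous b}.
  by apply: derivable_within_continuous_within; case: hb.
have cbeps := continuous_subspaceW IepsA cb.
have mbA : measurable_fun (A : set (measurableTypeR R)) b.
  exact: subspace_continuous_measurable_fun.
have mbI0 : measurable_fun (I0 : set (measurableTypeR R)) b.
  exact: measurable_funS mbA.
have mbhatI0 : measurable_on I0 bhat.
  by apply: measurable_funS mbhat => //; [exact: measurableX|move=> p [_ /I0A]].
have mpatch : measurable_fun [set: T * measurableTypeR R]
    (fun p => (bhat p.1 \_ A) p.2).
  have := (measurable_restrictT _ (measurableX measurableT mA)).1 mbhat.
  congr measurable_fun; apply/funext => -[w x].
  by rewrite !patchE in_setX in_setT.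
(* Bandwidths that are functions of [w] cover both the constant pairs of the grid and the selected
   pair. *)
have mest (l h : T -> R) : measurable_fun [set: T] l ->
    measurable_fun [set: T] h -> (forall w, 0 < l w) -> (forall w, 0 < h w) ->
    measurable_on I0
      (fun w => monotone_estimator K l0 r0 eps b (bhat w) (l w) (h w)).
  move=> ml mh lp hp; apply: measurable_funTS.
  under eq_fun do rewrite -monotone_estimator_patch.
  apply: (@measurable_monotone_estimator _ _ _ _ _ _ _ _
    (fun p : T * measurableTypeR R => bhat p.1 \_ A)
    (fun p => l p.1) (fun p => h p.1) snd) => //; try exact: measurableT_comp.
  apply: (measurableT_comp mpatch
    (g := fun p : T * measurableTypeR R * measurableTypeR R => (p.1.1, p.2))).
  by apply: measurable_fun_pair => //; exact: measurableT_comp.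
have Hgt0 u : u \in H -> 0 < u by move/H0; rewrite in_itv/= => /andP[].
have lhat0 w : 0 < lhat w.
  by have [+ _] := hargmin w; rewrite in_fsetM => /andP[/Hgt0].
have hhat0 w : 0 < hhat w.
  by have [+ _] := hargmin w; rewrite in_fsetM => /andP[_ /Hgt0].
apply: le_mule_bigmin => [//||p pH]; first exact: L1_risk_ge0.
have /andP[/Hgt0 p10 /Hgt0 p20] : (p.1 \in H) && (p.2 \in H).
  by rewrite -in_fsetM; case: p pH.
have mestp := mest (fun=> p.1) (fun=> p.2) (measurable_cst _)
  (measurable_cst _) (fun=> p10) (fun=> p20).
have mesthat := mest lhat hhat mlhat mhhat lhat0 hhat0.
have hat_le w := (hargmin w).2 p pH.
apply: (le_trans (L1_risk_oracle P mI0 mbI0 mesthat mestp mbhatI0 hat_le)).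
have riskI0A := L1_risk_subset P mI0 mA mbA mbhat I0A.
apply: (le_trans (leeD2l _ (leeD riskI0A riskI0A))).
(* The factor 2 is forced by the risk of [bhat]; the competitor's risk is doubled along with it,
   which only enlarges the bound since risks are nonnegative. *)
rewrite ge0_muleDr ?L1_risk_ge0// !mule_natl !mule2n leeD2r//.
by rewrite leeDl// L1_risk_ge0.
Qed.
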